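(* Let $\{(x_i,y_i)\in\mathbb{R}^2 : i=0,\ldots,N\}$ be interpolation data, let $\big\{\{\mathbb{R}^2;\omega_{n,k}: n=1,\ldots,N\},\ k=1,\ldots,M\big\}$ be an associated Super Iterated Function System (as defined in the context), and let $\sigma=\sigma_1\sigma_2\ldots\sigma_k\ldots\in\Lambda$. Let $G_\sigma$ be the attractor of this system for $\sigma$. Then $G_\sigma$ is the graph of a continuous function $g_\sigma: I\to\mathbb{R}$ such that $g_\sigma(x_n)=y_n$ for all $n=0,\ldots,N$.
   Context: Let $N\ge 2$, $M>1$ be integers, $x_0<x_1<\cdots<x_N$ reals, $y_0,\ldots,y_N\in\mathbb{R}$, $S_0=\{(x_i,y_i): i=0,\ldots,N\}$, $I=[x_0,x_N]$, $I_n=[x_{n-1},x_n]$. For $n=1,\ldots,N$ let $L_n(x)=a_nx+b_n=\dfrac{(x_n-x_{n-1})x+(x_Nx_{n-1}-x_0x_n)}{x_N-x_0}$, so that $L_n$ maps $I$ onto $I_n$ with $L_n(x_0)=x_{n-1}$, $L_n(x_N)=x_n$. For $n=1,\ldots,N$ and $k=1,\ldots,M$ let $G_{n,k}(x,y)=e_{n,k}x+\gamma_{n,k}y+f_{n,k}$, where $\gamma_{n,k}$ are real parameters with $|\gamma_{n,k}|<1$ and $\gamma_{n,k}\ne\gamma_{n,l}$ for $k\neq l$, and the reals $e_{n,k},f_{n,k}$ are such that the join-up conditions $G_{n,k}(x_0,y_0)=y_{n-1}$ and $G_{n,k}(x_N,y_N)=y_n$ hold. Put $\omega_{n,k}(x,y)=(L_n(x),G_{n,k}(x,y))$.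 The Super Iterated Function System (SIFS) is the pool of IFSs $\big\{\{\mathbb{R}^2;\omega_{n,k}: n=1,\ldots,N\},\ k=1,\ldots,M\big\}$. Let $\mathcal{H}(\mathbb{R}^2)$ be the set of nonempty compact subsets of $\mathbb{R}^2$ with the Hausdorff metric, and for $A\in\mathcal{H}(\mathbb{R}^2)$ let $W_k(A)=\bigcup_{n=1}^N\omega_{n,k}(A)$. Let $\Lambda$ be the set of infinite sequences $\sigma=\sigma_1\sigma_2\ldots$ with $\sigma_j\in\{1,\ldots,M\}$. The attractor of the SIFS for $\sigma\in\Lambda$ is the set $G_\sigma=\lim_{k\to\infty}W_{\sigma_k}\circ W_{\sigma_{k-1}}\circ\cdots\circ W_{\sigma_1}(S_0)$, the limit being taken in the Hausdorff metric; ''let $G_\sigma$ be the attractor for $\sigma$'' means that this limit exists and equals $G_\sigma$. *)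

(* Defs.v *)
From mathcomp Require Import all_boot all_order all_algebra.
From mathcomp Require Import all_classical all_reals all_analysis.

Set Implicit Arguments.
Unset Strict Implicit.
Unset Printing Implicit Defensive.

Import Order.TTheory GRing.Theory Num.Theory.
Import numFieldNormedType.Exports.

Local Open Scope classical_set_scope.
Local Open Scope ring_scope.

(* The library's metric on R * R is the sup one; the plane is meant here with
   its Euclidean distance. *)
Definition eucl_dist {R : realType} (p q : R * R) : R :=
  Num.sqrt ((p.1 - q.1) ^+ 2 + (p.2 - q.2) ^+ 2).

Definition dist_to_set {R : realType} (p : R * R) (B : set (R * R)) : R :=
  inf [set eucl_dist p q | q in B].

Definition excess {R : realType} (A B : set (R * R)) : R :=
  sup [set dist_to_set p B | p in A].

(* Meaningful on nonempty compact sets only: the real [sup] and [inf] take the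
   value 0 on empty or unbounded sets. *)
Definition hausdorff_dist {R : realType} (A B : set (R * R)) : R :=
  Num.max (excess A B) (excess B A).

(* Membership in H(R^2). *)
Definition nonempty_compact {R : realType} (A : set (R * R)) : Prop :=
  A !=set0 /\ compact A.

(* The maps are numbered from 0: n : 'I_N stands for the index n + 1 in
   {1, ..., N}, so that its subinterval has endpoints numbered n and n + 1. *)
Definition left_end {N : nat} (n : 'I_N) : 'I_N.+1 := widen_ord (leqnSn N) n.
Definition right_end {N : nat} (n : 'I_N) : 'I_N.+1 := lift ord0 n.

Definition L_map {R : realType} {N : nat} (x : 'I_N.+1 -> R) (n : 'I_N)
    (t : R) : R :=
  ((x (right_end n) - x (left_end n)) * t
     + (x ord_max * x (left_end n) - x ord0 * x (right_end n)))
  / (x ord_max - x ord0).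

Definition G_map {R : realType} {N M : nat} (e gamma f : 'I_N -> 'I_M -> R)
    (n : 'I_N) (k : 'I_M) (p : R * R) : R :=
  e n k * p.1 + gamma n k * p.2 + f n k.

Definition omega {R : realType} {N M : nat} (x : 'I_N.+1 -> R)
    (e gamma f : 'I_N -> 'I_M -> R) (n : 'I_N) (k : 'I_M) (p : R * R) : R * R :=
  (L_map x n p.1, G_map e gamma f n k p).

Definition is_SIFS {R : realType} {N M : nat} (x y : 'I_N.+1 -> R)
    (e gamma f : 'I_N -> 'I_M -> R) : Prop :=
  [/\ forall n k, `|gamma n k| < 1,
      forall n k l, k <> l -> gamma n k <> gamma n l,
      forall n k, G_map e gamma f n k (x ord0, y ord0) = y (left_end n) &
      forall n k, G_map e gamma f n k (x ord_max, y ord_max) = y (right_end n)].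

Definition data_points {R : realType} {N : nat} (x y : 'I_N.+1 -> R) :
    set (R * R) :=
  [set (x i, y i) | i in [set: 'I_N.+1]].

Definition W {R : realType} {N M : nat} (x : 'I_N.+1 -> R)
    (e gamma f : 'I_N -> 'I_M -> R) (k : 'I_M) (A : set (R * R)) :
    set (R * R) :=
  \bigcup_(n in [set: 'I_N]) (omega x e gamma f n k @` A).

(* W_{sigma_k} o ... o W_{sigma_1} applied to A, where sigma j is the letter
   sigma_{j+1}: each new map is applied last. *)
Fixpoint W_iter {R : realType} {N M : nat} (x : 'I_N.+1 -> R)
    (e gamma f : 'I_N -> 'I_M -> R) (sigma : nat -> 'I_M) (A : set (R * R))
    (k : nat) : set (R * R) :=
  if k is k'.+1
  then W x e gamma f (sigma k') (W_iter x e gamma f sigma A k')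
  else A.

Lemma W_iter_nonempty_compact {R : realType} {N M : nat}
    (x y : 'I_N.+1 -> R) (e gamma f : 'I_N -> 'I_M -> R) (sigma : nat -> 'I_M)
    (k : nat) :
  (0 < N)%N ->
  nonempty_compact (W_iter x e gamma f sigma (data_points x y) k).
Proof.
move=> N0; set A := W_iter _ _ _ _ _ _.
have [? ?] : A k !=set0 /\ finite_set (A k).
  elim: k => [|k [[p Ap] finA]]; split.
  - by exists (x ord0, y ord0); exists ord0.
  - exact/finite_image/finite_finset.
  - exists (omega x e gamma f (Ordinal N0) (sigma k) p).
    by exists (Ordinal N0) => //; exists p.
  - by apply: bigcup_finite => [|i _]; [exact: finite_finset|exact: finite_image].
by split=> //; exact: finite_compact.
Qed.

Definition is_attractor {R : realType} {N M : nat} (x y : 'I_N.+1 -> R)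
    (e gamma f : 'I_N -> 'I_M -> R) (sigma : nat -> 'I_M)
    (G : set (R * R)) : Prop :=
  nonempty_compact G /\
  hausdorff_dist (W_iter x e gamma f sigma (data_points x y) k) G
    @[k --> \oo] --> (0 : R).

(* Main.v *)
Require Import Defs.
From mathcomp Require Import all_boot all_order all_algebra.
From mathcomp Require Import all_classical all_reals all_analysis.
From mathcomp Require Import ring lra.

Set Implicit Arguments.
Unset Strict Implicit.
Unset Printing Implicit Defensive.

Import Order.TTheory GRing.Theory Num.Theory.
Import numFieldNormedType.Exports.

Local Open Scope classical_set_scope.
Local Open Scope ring_scope.

(** Write A_k for the k-th iterate of the data set. Each A_k is a finite set,
    and successive iterates need not approach one another, since the letters of
    sigma keep changing: no fixed-point argument is available. What survives is
    compactness of Arzela-Ascoli type. The A_k are uniformly equicontinuous: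
    for every eps there is one delta such that, whatever k, two points of A_k
    with abscissae closer than delta have ordinates within eps of one another
    ([W_iter_equicontinuous]). This passes to a Hausdorff limit, and a compact
    set with that property is the graph of a continuous function on its
    projection ([equicontinuous_limit_graph]). The projection is all of I
    because the abscissae of A_k become dense in I ([W_iter_dense]), and the
    graph passes through the data because every A_k contains them
    ([nodes_mem]).

    Equicontinuity comes from the vertical contraction: with rho < 1 bounding
    all |gamma n k|, if oscillations at some scale are at most eps, then inside
    one subinterval oscillations at a finer scale are at most any prescribed
    eps' > rho * eps ([omega_osc]). Two close points may however lie on both
    sides of a node, and going through the node would cost a factor 2, which
    destroys the contraction as soon as rho >= 1/2. Hence the argument is run
    twice: first for the oscillation between a node and a point of A_k
    ([osc_at_nodes]), where a node is never crossed because it is the image of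
    an endpoint of I by the map that produces the neighbouring point; then for
    two arbitrary points, where the crossing of a node is already known to be
    harmless. *)

(** * Uniform bounds for finite families *)

Section FiniteFamilies.
Context {R : realType} {T : finType}.
Implicit Types F : T -> R.

Lemma finite_family_bounded F : exists2 B, 0 < B & forall i, `|F i| <= B.
Proof.
exists (1 + \sum_i `|F i|) => [|i].
  by rewrite ltr_pwDl// sumr_ge0.
rewrite (bigD1 i)//= addrCA lerDl addr_ge0// sumr_ge0//.
Qed.

Lemma finite_family_pos F :
  (forall i, 0 < F i) -> exists2 c, 0 < c & forall i, c <= F i.
Proof.
move=> F0; have [B B0 FB] := finite_family_bounded (fun i => (F i)^-1).
exists B^-1 => [|i]; first by rewrite invr_gt0.
rewrite -[F i]invrK lef_pV2 ?posrE ?invr_gt0//.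
exact: le_trans (ler_norm _) (FB i).
Qed.

Lemma finite_family_lt1 F : (forall i, `|F i| < 1) ->
  exists rho, [/\ 0 <= rho, rho < 1 & forall i, `|F i| <= rho].
Proof.
move=> F1; have [|c c0 cF] := @finite_family_pos (fun i => 1 - `|F i|).
  by move=> i; rewrite subr_gt0.
exists (Num.max 0 (1 - c)); split=> [||i].
- by rewrite le_max lexx.
- by rewrite gt_max ltr01/= ltrBlDr ltrDl.
- by rewrite le_max; apply/orP; right; have := cF i; lra.
Qed.
End FiniteFamilies.

(** * Iterating a contraction on moduli *)

Section Gauge.
Context {R : realType}.

Lemma geometric_small (r B eps : R) : 0 <= r -> r < 1 -> 0 < eps ->
  exists K, forall k, (K <= k)%N -> r ^+ k * B < eps.
Proof.
move=> r0 r1 eps0.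
have /cvgr0Pnorm_lt/(_ (eps / (`|B| + 1))) : r ^+ k @[k --> \oo] --> (0 : R).
  by apply: cvg_expr; rewrite ger0_norm.
have B1 : 0 < `|B| + 1 by rewrite ltr_wpDl.
case=> [|K _ hK]; first by rewrite divr_gt0.
exists K => k /hK/=; rewrite ltr_pdivlMr// => /(le_lt_trans _); apply.
rewrite normrX (ger0_norm r0) ler_wpM2l ?exprn_ge0//.
by rewrite (le_trans (ler_norm B))// lerDl.
Qed.

(** [P eps] is meant to say that oscillations are bounded by [eps] at some
    scale. A strict loss is allowed in the step, hence the contraction is
    iterated with the ratio (1 + rho) / 2, strictly above rho. *)
Lemma contraction_gauge (P : R -> Prop) (rho : R) :
    0 <= rho -> rho < 1 -> (exists B, P B) ->
    (forall eps eps', P eps -> rho * eps < eps' -> P eps') ->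
  forall eps, 0 < eps -> P eps.
Proof.
move=> rho0 rho1 [B PB] Pstep eps eps0.
pose r := (1 + rho) / 2.
have [r0 r1 rhor] : [/\ 0 < r, r < 1 & rho < r] by rewrite /r; split; lra.
have B0 : 0 < `|B| + 1 by rewrite ltr_wpDl.
have Pr k : P (r ^+ k * (`|B| + 1)).
  elim: k => [|k /Pstep]; last first.
    apply; rewrite exprS -mulrA ltr_pM2r//.
    by rewrite mulr_gt0// exprn_gt0.
  apply: (Pstep _ _ PB); rewrite expr0 mul1r.
  apply: (@le_lt_trans _ _ `|B|); last by rewrite ltrDl.
  apply: (le_trans (ler_norm _)); rewrite normrM (ger0_norm rho0).
  by rewrite ler_piMl// ltW.
have [K /(_ K (leqnn K)) hK] := geometric_small (`|B| + 1) (ltW r0) r1 eps0.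
apply: (Pstep _ _ (Pr K)); apply: le_lt_trans hK.
by rewrite ler_piMl ?mulr_ge0 ?exprn_ge0// ltW.
Qed.
End Gauge.

(** * The Hausdorff distance in the plane *)

Section HausdorffMetric.
Context {R : realType}.
Implicit Types (p q : R * R) (A B G : set (R * R)).

Lemma eucl_dist_ge1 p q : `|p.1 - q.1| <= eucl_dist p q.
Proof. by rewrite -sqrtr_sqr ler_wsqrtr// lerDl sqr_ge0. Qed.

Lemma eucl_dist_ge2 p q : `|p.2 - q.2| <= eucl_dist p q.
Proof. by rewrite -sqrtr_sqr ler_wsqrtr// lerDr sqr_ge0. Qed.

Lemma eucl_dist_le p q : eucl_dist p q <= `|p.1 - q.1| + `|p.2 - q.2|.
Proof.
rewrite -[leRHS]ger0_norm ?addr_ge0// -[leRHS]sqrtr_sqr ler_wsqrtr//.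
rewrite [leRHS]sqrrD !real_normK ?num_real// lerD2r lerDl mulrn_wge0// mulr_ge0//.
Qed.

Lemma compact_plane_bounded A : compact A ->
  exists C, forall p, A p -> `|p.1| <= C /\ `|p.2| <= C.
Proof.
move=> /compact_bounded[b [_ /(_ (b + 1))]]; rewrite ltrDl ltr01 => /(_ isT) hb.
exists (b + 1) => p Ap.
have : Num.max `|p.1| `|p.2| <= b + 1 by exact: hb Ap.
by rewrite ge_max => /andP[].
Qed.

Lemma dist_to_set_le p q A : A q -> dist_to_set p A <= eucl_dist p q.
Proof.
move=> Aq; apply: ge_inf; last by exists q.
by exists 0 => _ [r _ <-]; exact: sqrtr_ge0.
Qed.

(** Boundedness of [A] is what makes the real supremum in [excess] an upper
    bound of the distances. *)
Lemma near_of_excess_lt A B eps : nonempty_compact A -> nonempty_compact B ->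
  excess A B < eps -> forall p, A p ->
  exists2 q, B q & `|p.1 - q.1| < eps /\ `|p.2 - q.2| < eps.
Proof.
move=> [_ cA] [[b Bb] _] AB p Ap.
have [C hC] := compact_plane_bounded cA.
have pB : dist_to_set p B < eps.
  apply: le_lt_trans AB; apply: ub_le_sup; last by exists p.
  exists (C + `|b.1| + (C + `|b.2|)) => _ [r /hC[r1 r2] <-].
  apply: (le_trans (dist_to_set_le r Bb)); apply: (le_trans (eucl_dist_le _ _)).
  by rewrite lerD// (le_trans (ler_normB _ _))// lerD2r.
have [||_ [q Bq <-] pq] := @inf_adherent _ [set eucl_dist p q | q in B] (eps - dist_to_set p B).
- by rewrite subr_gt0.
- split; first by exists (eucl_dist p b); exists b.
  by exists 0 => _ [r _ <-]; exact: sqrtr_ge0.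
rewrite [X in _ < X]addrC subrK in pq; exists q => //; split.
- exact: le_lt_trans (eucl_dist_ge1 _ _) pq.
- exact: le_lt_trans (eucl_dist_ge2 _ _) pq.
Qed.

Lemma hausdorff_limit_near (A : nat -> set (R * R)) G :
    (forall k, nonempty_compact (A k)) -> nonempty_compact G ->
    hausdorff_dist (A k) G @[k --> \oo] --> (0 : R) ->
  forall eps, 0 < eps -> exists K, forall k, (K <= k)%N ->
    (forall p, A k p ->
       exists2 q, G q & `|p.1 - q.1| < eps /\ `|p.2 - q.2| < eps) /\
    (forall p, G p ->
       exists2 q, A k q & `|p.1 - q.1| < eps /\ `|p.2 - q.2| < eps).
Proof.
move=> cA cG /cvgr0Pnorm_lt AG eps /AG[K _ hK].
exists K => k /hK /(le_lt_trans (ler_norm _)); rewrite gt_max => /andP[AG' GA].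
by split; exact: near_of_excess_lt.
Qed.
End HausdorffMetric.

(** * Hausdorff limits of equicontinuous sets *)

Section EquicontinuousLimit.
Context {R : realType}.

Lemma closed_approx {V : pseudoMetricType R} (C : set V) (v : V) : closed C ->
  (forall eps, 0 < eps -> exists2 w, C w & ball v eps w) -> C v.
Proof.
move=> cC hv; apply: cC => U /nbhs_ballP[eps /= eps0 epsU].
by have [w Cw vw] := hv _ eps0; exists w; split => //; exact: epsU.
Qed.

Lemma plane_compact_closed (G : set (R * R)) : compact G -> closed G.
Proof. by apply: compact_closed; exact: norm_hausdorff. Qed.

Lemma compact_abscissae (G : set (R * R)) : compact G -> compact (fst @` G).
Proof.
move=> cG; apply: continuous_compact => //.
by apply: continuous_subspaceT => p; exact: cvg_fst.
Qed.

(** Equicontinuity passes to [G]: two points of [G]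
    are replaced by nearby points of one [A k]. Equicontinuity of [G] then gives
    both uniqueness of the ordinate and continuity. Above each abscissa there is
    a point of [G], because the projection of [G] is closed and the density of
    the abscissae of [A k] makes it dense in the interval. *)
Lemma equicontinuous_limit_graph (A : nat -> set (R * R)) (G : set (R * R))
    (a b : R) :
    compact G ->
    (forall k p, A k p -> a <= p.1 <= b) ->
    (forall eps, 0 < eps -> exists K, forall k, (K <= k)%N ->
      forall t, a <= t <= b -> exists2 p, A k p & `|p.1 - t| < eps) ->
    (forall eps, 0 < eps -> exists2 delta, 0 < delta &
      forall k p q, A k p -> A k q ->
        `|p.1 - q.1| < delta -> `|p.2 - q.2| <= eps) ->
    (forall eps, 0 < eps -> exists K, forall k, (K <= k)%N ->
      (forall p, A k p ->
         exists2 q, G q & `|p.1 - q.1| < eps /\ `|p.2 - q.2| < eps) /\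
      (forall p, G p ->
         exists2 q, A k q & `|p.1 - q.1| < eps /\ `|p.2 - q.2| < eps)) ->
  exists g : R -> R, {within `[a, b], continuous g} /\
    G = [set (t, g t) | t in `[a, b]].
Proof.
move=> cG Aab Adense Aequi AG.
have Gab p : G p -> a <= p.1 <= b.
  move=> Gp.
  suff : `[a, b]%classic p.1 by rewrite /= in_itv.
  apply: closed_approx; first exact: interval_closed.
  move=> eps eps0; have [K /(_ K (leqnn K))[_ GA]] := AG _ eps0.
  have [q Aq [pq _]] := GA _ Gp.
  exists q.1; first by rewrite /= in_itv /=; exact: Aab Aq.
  by rewrite -ball_normE.
have Gdom t : a <= t <= b -> exists u, G (t, u).
  move=> tab; suff [[s u] Gp <-] : (fst @` G) t by exists u.
  apply: closed_approx; first by apply: compact_closed;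
    [exact: norm_hausdorff|exact: compact_abscissae].
  move=> eps eps0; have e2 : 0 < eps / 2 by rewrite divr_gt0.
  have [K1 hK1] := Adense _ e2; have [K2 hK2] := AG _ e2.
  have [p Ap pt] := hK1 (maxn K1 K2) (leq_maxl _ _) t tab.
  have [q Gq [pq _]] := (hK2 (maxn K1 K2) (leq_maxr _ _)).1 _ Ap.
  exists q.1; first by exists q.
  rewrite -ball_normE /= (_ : t - q.1 = (p.1 - q.1) - (p.1 - t)); last by ring.
  by rewrite [eps]splitr (le_lt_trans (ler_normB _ _))// ltrD.
have Gequi eps : 0 < eps -> exists2 delta, 0 < delta & forall p q, G p -> G q ->
    `|p.1 - q.1| < delta -> `|p.2 - q.2| < eps.
  move=> eps0; have e4 : 0 < eps / 4 by rewrite divr_gt0.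
  have [delta d0 hd] := Aequi _ e4.
  have d3 : 0 < delta / 3 by rewrite divr_gt0.
  exists (delta / 3) => // p q Gp Gq pq.
  have [|K /(_ K (leqnn K))[_ GA]] := AG (Num.min (delta / 3) (eps / 4)).
    by rewrite lt_min d3.
  have [p' Ap' []] := GA _ Gp; rewrite !lt_min => /andP[p1 _] /andP[_ p2].
  have [q' Aq' []] := GA _ Gq; rewrite !lt_min => /andP[q1 _] /andP[_ q2].
  have : `|p'.2 - q'.2| <= eps / 4.
    apply: hd Ap' Aq' _; move: p1 q1 pq; rewrite !ltr_norml.
    move=> /andP[? ?] /andP[? ?] /andP[? ?]; apply/andP; split; lra.
  move: p2 q2; rewrite !ltr_norml ler_norml.
  by move=> /andP[? ?] /andP[? ?] /andP[? ?]; apply/andP; split; lra.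
have Gfun t u v : G (t, u) -> G (t, v) -> u = v.
  move=> Gu Gv; apply/eqP; rewrite -subr_eq0 -normr_le0 leNgt; apply/negP.
  move=> /Gequi[delta d0 /(_ _ _ Gu Gv)]; rewrite /= subrr normr0 ltxx.
  by move=> /(_ d0).
pose g t := xget 0 [set u | G (t, u)].
have Gg t : a <= t <= b -> G (t, g t).
  by move=> /Gdom[u Gu]; apply: (@xgetPex _ 0 [set u | G (t, u)]); exists u.
exists g; split.
  apply/subspace_continuousP => t; rewrite /= in_itv /= => tab.
  apply/cvgrPdist_lt => eps /Gequi[delta d0 hd].
  rewrite near_withinE; apply/nbhs_ballP; exists delta => //= s.
  rewrite -ball_normE /= in_itv /= => ts sab.
  exact: (hd (t, g t) (s, g s) (Gg _ tab) (Gg _ sab) ts).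
apply/seteqP; split => [[t u] Gp|_ [t tab <-]]; last first.
  by apply: Gg; move: tab; rewrite /= in_itv.
have tab := Gab _ Gp.
exists t; first by rewrite /= in_itv.
by rewrite (Gfun _ _ _ Gp (Gg _ tab)).
Qed.
End EquicontinuousLimit.

(** * The maps of the iterated function systems *)

Section SuperIFS.
Context {R : realType} {N M : nat}.
Context (x y : 'I_N.+1 -> R) (e gamma f : 'I_N -> 'I_M -> R).
Hypothesis N2 : (2 <= N)%N.
Hypothesis hx : forall i j : 'I_N.+1, (i < j)%N -> x i < x j.
Hypothesis hS : is_SIFS x y e gamma f.

Local Notation om := (omega x e gamma f).
Local Notation slope n :=
  ((x (right_end n) - x (left_end n)) / (x ord_max - x ord0)).

Let node_le (i j : 'I_N.+1) : (i <= j)%N -> x i <= x j.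
Proof.
by rewrite leq_eqVlt => /orP[/eqP/val_inj->//|/hx/ltW].
Qed.

Let node_itv i : x ord0 <= x i <= x ord_max.
Proof. by rewrite !node_le//= -ltnS. Qed.

Let width_gt0 : 0 < x ord_max - x ord0.
Proof. by rewrite subr_gt0 hx//= (leq_trans _ N2). Qed.

Lemma slope_gt0 n : 0 < slope n.
Proof. by rewrite divr_gt0// subr_gt0 hx. Qed.

Lemma slope_lt1 n : slope n < 1.
Proof.
rewrite ltr_pdivrMr// mul1r.
have /andP[l0 _] := node_itv (left_end n).
have /andP[_ rN] := node_itv (right_end n).
have [n0|n0] := posnP n.
  have : x (right_end n) < x ord_max by apply: hx; rewrite /= /bump n0.
  lra.
have : x ord0 < x (left_end n) by apply: hx.
lra.
Qed.

Lemma L_mapB n s t : L_map x n s - L_map x n t = slope n * (s - t).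
Proof. by rewrite /L_map; field; rewrite gt_eqF. Qed.

Lemma L_map_left n : L_map x n (x ord0) = x (left_end n).
Proof. by rewrite /L_map; field; rewrite gt_eqF. Qed.

Lemma L_map_right n : L_map x n (x ord_max) = x (right_end n).
Proof. by rewrite /L_map; field; rewrite gt_eqF. Qed.

Lemma omega_left n l : om n l (x ord0, y ord0) = (x (left_end n), y (left_end n)).
Proof. by case: hS => _ _ h _; rewrite /omega /= L_map_left h. Qed.

Lemma omega_right n l :
  om n l (x ord_max, y ord_max) = (x (right_end n), y (right_end n)).
Proof. by case: hS => _ _ _ h; rewrite /omega /= L_map_right h. Qed.

Lemma L_map_itv n t : x ord0 <= t <= x ord_max ->
  x (left_end n) <= L_map x n t <= x (right_end n).
Proof.
move=> /andP[t0 tN]; rewrite -(L_map_left n) -(L_map_right n).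
rewrite -subr_ge0 L_mapB -[X in _ && X]subr_ge0 L_mapB.
by have s0 := ltW (slope_gt0 n); rewrite mulr_ge0 ?subr_ge0// mulr_ge0 ?subr_ge0//.
Qed.

(** With [omega_left] and [omega_right], every datum is the image of the first
    or of the last one under every system of the pool. *)
Lemma endpoint_cases (i : 'I_N.+1) :
  (exists n, i = left_end n) \/ (exists n, i = right_end n).
Proof.
case: (unliftP ord0 i) => [n ->|->]; first by right; exists n.
by left; exists (Ordinal (ltnW N2)); exact: val_inj.
Qed.

Lemma subinterval_cover t : x ord0 <= t <= x ord_max ->
  exists n, x (left_end n) <= t <= x (right_end n).
Proof.
move=> /andP[t0 tN].
have := @arg_minnP _ ord_max (fun i => t <= x i) (@nat_of_ord _) tN.
case=> i ti imin; case: (unliftP ord0 i) => [n|] ?; subst i.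
  exists n; rewrite ti andbT leNgt; apply/negP => /ltW/imin.
  by rewrite /= /bump /= add1n ltnn.
exists (Ordinal (ltnW N2)); rewrite (_ : left_end _ = ord0); last exact: val_inj.
by rewrite t0 (le_trans ti)//; case/andP: (node_itv (right_end (Ordinal (ltnW N2)))).
Qed.

Lemma subinterval_cover_image t : x ord0 <= t <= x ord_max ->
  exists n, exists2 s, x ord0 <= s <= x ord_max & t = L_map x n s.
Proof.
move=> /subinterval_cover[n /andP[lt tr]]; exists n.
pose s := x ord0 + (t - x (left_end n)) / slope n.
have ts : t = L_map x n s.
  have : slope n * (s - x ord0) = t - x (left_end n).
    by rewrite /s addrAC subrr add0r mulrC divfK// gt_eqF// slope_gt0.
  by rewrite -L_mapB L_map_left => /addIr.
exists s => //; apply/andP; split.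
  by rewrite -subr_ge0 -(pmulr_rge0 _ (slope_gt0 n)) -L_mapB -ts L_map_left subr_ge0.
by rewrite -subr_ge0 -(pmulr_rge0 _ (slope_gt0 n)) -L_mapB -ts L_map_right subr_ge0.
Qed.

Lemma omega_lipschitz : exists C rho, [/\ 0 < C, 0 <= rho, rho < 1 &
  forall n l p q, `|(om n l p).2 - (om n l q).2| <=
    C * `|p.1 - q.1| + rho * `|p.2 - q.2|].
Proof.
case: hS => gamma1 _ _ _.
have [rho [rho0 rho1 grho]] := @finite_family_lt1 R ('I_N * 'I_M)%type
  (fun i => gamma i.1 i.2) (fun i => gamma1 i.1 i.2).
have [C C0 eC] := @finite_family_bounded R ('I_N * 'I_M)%type (fun i => e i.1 i.2).
exists C, rho; split => // n l p q.
rewrite /= /G_map (_ : _ - _ = e n l * (p.1 - q.1) + gamma n l * (p.2 - q.2));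
  last by ring.
rewrite (le_trans (ler_normD _ _))// !normrM.
by rewrite lerD// ler_wpM2r// ?(eC (n, l))// (grho (n, l)).
Qed.

(** One step of the contraction of oscillations. The term in [C] comes from the
    shear [e] and is made smaller than the gap eps' - rho * eps by refining the
    scale; dividing by [c], a lower bound of the slopes, turns a scale for the
    images into a scale for the arguments. *)
Lemma omega_osc : exists rho, [/\ 0 <= rho, rho < 1 &
  forall eps eps' delta, 0 < delta -> rho * eps < eps' ->
  exists2 delta', 0 < delta' & forall n l p q,
    `|(om n l p).1 - (om n l q).1| < delta' ->
    `|p.1 - q.1| < delta /\
    (`|p.2 - q.2| <= eps -> `|(om n l p).2 - (om n l q).2| <= eps')].
Proof.
have [C [rho [C0 rho0 rho1 omC]]] := omega_lipschitz.
have [c c0 cslope] := @finite_family_pos R _ (fun n => slope n) slope_gt0.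
exists rho; split => // eps eps' delta d0 hrho.
pose m := Num.min delta ((eps' - rho * eps) / C).
have m0 : 0 < m by rewrite lt_min d0 divr_gt0// subr_gt0.
exists (c * m) => [|n l p q]; first by rewrite mulr_gt0.
rewrite [X in X < _]/= L_mapB normrM (gtr0_norm (slope_gt0 n)) => pq.
have {pq} : `|p.1 - q.1| < m.
  by rewrite -(ltr_pM2l c0); apply: le_lt_trans pq; rewrite ler_wpM2r.
rewrite lt_min ltr_pdivlMr// => /andP[-> pq]; split => // pqeps.
apply: (le_trans (omC _ _ _ _)).
have := ler_wpM2l rho0 pqeps; rewrite mulrC in pq; lra.
Qed.

(** * Oscillation of the iterates *)

Context (sigma : nat -> 'I_M).
Local Notation A := (W_iter x e gamma f sigma (data_points x y)).

(** The data set is contained in its image by any system of the pool, so the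
    initial set needs no separate treatment: each iterate can be regarded as
    part of an image of some iterate. *)
Lemma W_iter_pred k :
  exists j l, A k `<=` W x e gamma f l (A j).
Proof.
case: k => [|k]; last by exists k, (sigma k).
exists 0%N, (sigma 0%N) => _ [i _ <-].
have [[n ->]|[n ->]] := endpoint_cases i; exists n => //.
  by exists (x ord0, y ord0); [exists ord0|exact: omega_left].
by exists (x ord_max, y ord_max); [exists ord_max|exact: omega_right].
Qed.

Lemma nodes_mem k i : A k (x i, y i).
Proof.
elim: k i => [i|k IH i]; first by exists i.
have [[n ->]|[n ->]] := endpoint_cases i; exists n => //.
  by exists (x ord0, y ord0); [exact: IH|exact: omega_left].
by exists (x ord_max, y ord_max); [exact: IH|exact: omega_right].
Qed.

Lemma W_iter_itv k p : A k p -> x ord0 <= p.1 <= x ord_max.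
Proof.
elim: k p => [_ [i _ <-]|k IH _ [n _ [p /IH pI <-]]]; first exact: node_itv.
have /andP[l r] := L_map_itv n pI.
have /andP[l0 _] := node_itv (left_end n).
have /andP[_ rN] := node_itv (right_end n).
by rewrite /= (le_trans l0)// (le_trans r).
Qed.

Lemma W_iter_bounded : exists B, forall k p, A k p -> `|p.2| <= B.
Proof.
have [C [rho [C0 rho0 rho1 omC]]] := omega_lipschitz.
have [Y Y0 yY] := finite_family_bounded y.
have r0 : 0 < 1 - rho by rewrite subr_gt0.
pose w := x ord_max - x ord0; have w0 : 0 <= w by exact: ltW.
pose D := (C * w + Y + Y) / (1 - rho).
have D0 : 0 <= D by rewrite divr_ge0 ?(ltW r0)// !addr_ge0 ?mulr_ge0// ltW.
(* The ordinate of a node differs from that of the first datum by at most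
   Y + Y, hence a bound B on the distance to the first ordinate is kept by
   the next step if C * w + rho * B + Y + Y <= B, which D + Y + Y satisfies. *)
suff hD k p : A k p -> `|p.2 - y ord0| <= D + Y + Y.
  exists (D + Y + Y + Y) => k p /hD pD.
  rewrite -(subrK (y ord0) p.2) (le_trans (ler_normD _ _))// lerD//.
elim: k p => [_ [i _ <-]|k IH _ [n _ [p Ap <-]]].
  rewrite /= (le_trans (ler_normB _ _))// -addrA ler_wpDl// lerD//.
have pw : `|p.1 - x ord0| <= w.
  have /andP[p0 pN] := W_iter_itv Ap.
  by rewrite ger0_norm ?subr_ge0// lerD2r.
have := omC n (sigma k) p (x ord0, y ord0); rewrite omega_left /= => h.
rewrite -(subrKA (y (left_end n))) (le_trans (ler_normD _ _))//.
have h1 := ler_wpM2l (ltW C0) pw.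
have h2 := ler_wpM2l rho0 (IH _ Ap).
have h3 : `|y (left_end n) - y ord0| <= Y + Y.
  by rewrite (le_trans (ler_normB _ _))// lerD.
have DE : D * (1 - rho) = C * w + Y + Y by rewrite /D divfK// gt_eqF.
have h4 : 0 <= (1 - rho) * Y by rewrite mulr_ge0// ltW.
lra.
Qed.

(** A point of A_k close to a node lies in the image of one of the maps having
    this node as an endpoint of its subinterval. The node is thus the image of
    the first or last datum by this same map, and oscillation at the nodes is
    controlled by oscillation at the nodes one step earlier. *)
Lemma osc_at_nodes eps : 0 < eps -> exists2 delta, 0 < delta &
  forall k p i, A k p -> `|p.1 - x i| < delta -> `|p.2 - y i| <= eps.
Proof.
have [rho [rho0 rho1 hrho]] := omega_osc.
move: eps; apply: (contraction_gauge rho0 rho1).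
  have [B hB] := W_iter_bounded; exists (B + B), 1 => // k p i Ap _.
  by rewrite (le_trans (ler_normB _ _))// lerD ?(hB _ _ Ap)// (hB _ _ (nodes_mem k i)).
move=> eps eps' [delta d0 IH] /(hrho _ _ _ d0)[delta' d'0 hd'].
(* [d] is a lower bound of the gaps between nodes: below this scale the node
   [x i] must be an endpoint of the subinterval containing the point. *)
have [d sep0 sep] : exists2 d, 0 < d & forall i j : 'I_N.+1, (i < j)%N -> d <= x j - x i.
  have [|d ? hd] := @finite_family_pos R ('I_N.+1 * 'I_N.+1)%type
    (fun ij => if (ij.1 < ij.2)%N then x ij.2 - x ij.1 else 1).
    by move=> [i j] /=; case: ifP => // /hx; rewrite subr_gt0.
  by exists d => // i j ij; have := hd (i, j); rewrite /= ij.
exists (Num.min delta' d) => [|k p i]; first by rewrite lt_min d'0.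
have [j [l sub]] := W_iter_pred k.
move=> /sub[n _ [q Aq <-]]; rewrite lt_min => /andP[qd' qd].
have /(L_map_itv n)/andP[nl nr] := W_iter_itv Aq.
have [ni|ni] : i = left_end n \/ i = right_end n.
- have [iltn|ngti|/val_inj] := ltngtP i (left_end n); last by left.
    have {iltn} := sep _ _ iltn; move: qd; rewrite ltr_norml /= => /andP[? ?] ?; exfalso; lra.
  have [iltn|igtn|/val_inj] := ltngtP i (right_end n); last by right.
    by move: iltn ngti; rewrite /= /bump/= add1n ltnS leqNgt => /negP.
  have {ngti igtn} := sep _ _ igtn; move: qd; rewrite ltr_norml /= => /andP[? ?] ?; exfalso; lra.
- move: qd'; rewrite ni -[x (left_end n)]/((x (left_end n), y (left_end n)).1).
  rewrite -[y (left_end n)]/((x (left_end n), y (left_end n)).2).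
  by rewrite -(omega_left n l) => /hd'[/(IH _ _ _ Aq) h]; apply.
- move: qd'; rewrite ni -[x (right_end n)]/((x (right_end n), y (right_end n)).1).
  rewrite -[y (right_end n)]/((x (right_end n), y (right_end n)).2).
  by rewrite -(omega_right n l) => /hd'[/(IH _ _ _ Aq) h]; apply.
Qed.

(** Two close points in the same subinterval are images of two points by one
    map, which contracts their oscillation. Two close points in different
    subintervals are separated by a node close to both of them, and
    [osc_at_nodes] bounds the oscillation by eps' / 2 on each side of it. *)
Lemma W_iter_equicontinuous eps : 0 < eps -> exists2 delta, 0 < delta &
  forall k p q, A k p -> A k q -> `|p.1 - q.1| < delta -> `|p.2 - q.2| <= eps.
Proof.
have [rho [rho0 rho1 hrho]] := omega_osc.
move: eps; apply: (contraction_gauge rho0 rho1).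
  have [B hB] := W_iter_bounded; exists (B + B), 1 => // k p q Ap Aq _.
  by rewrite (le_trans (ler_normB _ _))// lerD ?(hB _ _ Ap)// (hB _ _ Aq).
move=> eps eps' [delta d0 IH] epseps'.
(* The data lie in A_0, so an admissible [eps] is nonnegative. *)
have eps'0 : 0 < eps'.
  apply: le_lt_trans epseps'; rewrite mulr_ge0//.
  have := IH 0%N _ _ (nodes_mem 0 ord0) (nodes_mem 0 ord0).
  by rewrite !subrr normr0; exact.
have [delta1 d10 hd1] := hrho _ _ _ d0 epseps'.
have [|delta2 d20 hd2] := @osc_at_nodes (eps' / 2); first by rewrite divr_gt0.
exists (Num.min delta1 delta2) => [|k]; first by rewrite lt_min d10.
have cross j l (n m : 'I_N) p q : (n < m)%N -> A k (om n l p) -> A k (om m l q) ->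
    A j p -> A j q -> `|(om n l p).1 - (om m l q).1| < delta2 ->
    `|(om n l p).2 - (om m l q).2| <= eps'.
  move=> nm Akp Akq Ap Aq.
  have /(L_map_itv n)/andP[_ nr] := W_iter_itv Ap.
  have /(L_map_itv m)/andP[ml _] := W_iter_itv Aq.
  have rl : x (right_end n) <= x (left_end m) by apply: node_le.
  rewrite ltr_norml => /andP[pq _].
  have hp := hd2 k _ (left_end m) Akp; have hq := hd2 k _ (left_end m) Akq.
  rewrite -(subrKA (y (left_end m))) (le_trans (ler_normD _ _))//.
  rewrite [eps']splitr lerD//.
    by apply: hp; rewrite ltr_norml; move: pq; rewrite /= => pq; apply/andP; split; lra.
  rewrite distrC; apply: hq; rewrite ltr_norml; move: pq; rewrite /= => pq.
  by apply/andP; split; lra.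
have [j [l sub]] := W_iter_pred k.
move=> p' q' Ap' Aq'; have [n _ [p Ap pE]] := sub _ Ap'; have [m _ [q Aq qE]] := sub _ Aq'.
move: Ap' Aq'; rewrite -{}pE -{}qE lt_min => Ap' Aq' /andP[h1 h2].
have [nm|mn|/val_inj nm] := ltngtP n m.
- exact: (cross j l).
- by rewrite distrC; apply: (cross j l) => //; rewrite distrC.
- by subst m; have [/(IH _ _ _ Ap Aq) h] := hd1 _ _ _ _ h1; apply.
Qed.

(** A map of slope at most [r] < 1 turns a net of mesh m of I into a net of
    mesh r * m of its subinterval, and these cover I. *)
Lemma W_iter_dense eps : 0 < eps -> exists K, forall k, (K <= k)%N ->
  forall t, x ord0 <= t <= x ord_max -> exists2 p, A k p & `|p.1 - t| < eps.
Proof.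
have [r [r0 r1 hr]] : exists r, [/\ 0 <= r, r < 1 & forall n, `|slope n| <= r].
  by apply: finite_family_lt1 => n; rewrite gtr0_norm ?slope_gt0 ?slope_lt1.
move=> /(geometric_small (x ord_max - x ord0) r0 r1)[K hK].
exists K => k /hK small t tI.
suff [p Ap pt] : exists2 p, A k p & `|p.1 - t| <= r ^+ k * (x ord_max - x ord0).
  by exists p => //; exact: le_lt_trans small.
elim: k {small} t tI => [t /andP[t0 tN]|k IH _ /subinterval_cover_image[n [t /IH[p Ap pt] ->]]].
  exists (x ord0, y ord0); first by exists ord0.
  by rewrite expr0 mul1r distrC /= ger0_norm ?subr_ge0// lerD2r.
exists (om n (sigma k) p); first by exists n => //; exists p.
by rewrite /= L_mapB normrM exprS -mulrA ler_pM.
Qed.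

End SuperIFS.

(** * The attractor is the graph of an interpolation function *)

Theorem theorem2p1 (R : realType) (N M : nat) (hN : (2 <= N)%N) (hM : (1 < M)%N)
    (x y : 'I_N.+1 -> R) (hx : forall i j : 'I_N.+1, (i < j)%N -> x i < x j)
    (e gamma f : 'I_N -> 'I_M -> R) (hS : is_SIFS x y e gamma f)
    (sigma : nat -> 'I_M) (G : set (R * R))
    (hG : is_attractor x y e gamma f sigma G) :
  exists g : R -> R,
    [/\ {within `[x ord0, x ord_max], continuous g},
        G = [set (t, g t) | t in `[x ord0, x ord_max]] &
        forall i : 'I_N.+1, g (x i) = y i].
Proof.
have [cG AG] := hG.
have near := hausdorff_limit_near
  (fun k => W_iter_nonempty_compact x y e gamma f sigma k (ltnW hN)) cG AG.
have [g [gc GE]] := equicontinuous_limit_graph cG.2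
  (@W_iter_itv _ _ _ x y e gamma f hN hx sigma)
  (W_iter_dense y e gamma f hN hx sigma) (W_iter_equicontinuous hN hx hS sigma) near.
exists g; split => // i.
have : G (x i, y i).
  apply: closed_approx; first exact: plane_compact_closed cG.2.
  move=> eps /near[K /(_ K (leqnn K))[/(_ _ (nodes_mem hN hx hS sigma K i)) [q Gq [q1 q2]] _]].
  by exists q => //; split; rewrite -ball_normE.
by rewrite GE => -[t _ [-> ->]].
Qed.
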